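(* Let $\delta>0$, $d\ge1$, and let $G_X$ be the generator of a continuous-time Markov chain on $\delta\mathbb{Z}^d$, $$G_Xf(\delta k)=\sum_{\ell\in\mathbb{Z}^d}\beta_\ell(\delta k)\big(f(\delta(k+\ell))-f(\delta k)\big),\qquad k\in\mathbb{Z}^d,$$ where $\beta_\ell(\delta k)$ is the transition rate from $\delta k$ to $\delta(k+\ell)$. Fix $f:\delta\mathbb{Z}^d\to\mathbb{R}$ and assume that $$\sum_{\ell\in\mathbb{Z}^d}\big|\beta_\ell(\delta k)\big(f(\delta(k+\ell))-f(\delta k)\big)\big|<\infty,\qquad k\in\mathbb{Z}^d,$$ which is trivially satisfied when the number of possible transitions from each state is finite. For $x\in\mathbb{R}^d$ define $k(x)\in\mathbb{Z}^d$ by $k_i(x)=\lfloor x_i/\delta\rfloor$. Then, with $A$ the interpolation operator and $\alpha^k_{k+i}$ the one-dimensional weights (see context), $$AG_Xf(x)=\sum_{\ell\in\mathbb{Z}^d}A\beta_\ell(x)\big(Af(x+\delta\ell)-Af(x)\big)+\varepsilon(x),\qquad x\in\mathbb{R}^d,$$ where $$\varepsilon(x)=\sum_{\ell\in\mathbb{Z}^d}\ \sum_{i_1,\dots,i_d=0}^4\Big(\prod_{j=1}^d\alpha^{k_j(x)}_{k_j(x)+i_j}(x_j)\Big)\Big(\beta_\ell\big(\delta(k(x)+i)\big)-A\beta_\ell(x)\Big)\Big(f\big(\delta(k(x)+\ell+i)\big)-f\big(\delta(k(x)+i)\big)-\big(f(\delta(k(x)+\ell))-f(\delta k(x))\big)\Big)$$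 and $i=(i_1,\dots,i_d)$.
   Context: Interpolation operator. In one dimension, for $g:\delta\mathbb{Z}\to\mathbb{R}$ let $\Delta g(\delta k)=g(\delta(k+1))-g(\delta k)$, $\Delta^{j+1}g(\delta k)=\Delta^jg(\delta(k+1))-\Delta^jg(\delta k)$, and for $k\in\mathbb{Z}$, $x\in\mathbb{R}$, $t=(x-\delta k)/\delta$ put $$P_k(x)=g(\delta k)+t\big(\Delta-\tfrac12\Delta^2+\tfrac13\Delta^3\big)g(\delta k)+\tfrac12t^2\big(\Delta^2-\Delta^3\big)g(\delta k)+\tfrac16t^3\Delta^3g(\delta k)+\big(-\tfrac{23}{3}t^4+\tfrac{41}{2}t^5-\tfrac{55}{3}t^6+\tfrac{11}{2}t^7\big)\Delta^4g(\delta k).$$ Expanding the differences, $P_k(x)=\sum_{i=0}^4\alpha^k_{k+i}(x)g(\delta(k+i))$, where the weight $\alpha^k_{k+i}(x)$ is the coefficient of $g(\delta(k+i))$ (a polynomial in $t$ not depending on $g$). For $g:\delta\mathbb{Z}^d\to\mathbb{R}$ and $x\in\mathbb{R}^d$, $$Ag(x)=\sum_{i_1,\dots,i_d=0}^4\Big(\prod_{j=1}^d\alpha^{k_j(x)}_{k_j(x)+i_j}(x_j)\Big)g(\delta(k(x)+i)).$$ $A\beta_\ell$ denotes $A$ applied to $\delta k\mapsto\beta_\ell(\delta k)$ and $AG_Xf$ denotes $A$ applied to $\delta k\mapsto G_Xf(\delta k)$.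
   Formalization: The two series over ℓ on the right may diverge under the stated assumption; the identity is proved with both read as one sum over ℓ, and as displayed whenever the first (equivalently ε's) series converges absolutely, which holds if transitions from each state are finite in number. *)

(* Defs.v *)
From HB Require Import structures.
From mathcomp Require Import all_boot all_order all_algebra.
From mathcomp Require Import all_classical all_reals all_analysis.
From mathcomp Require Import ring.

Set Implicit Arguments.
Unset Strict Implicit.
Unset Printing Implicit Defensive.
Import Order.TTheory GRing.Theory Num.Theory.
Local Open Scope classical_set_scope.
Local Open Scope ring_scope.

(* As delta > 0, k |-> delta k is a bijection from Z^d to delta Z^d. A function
   g on delta Z^d is represented by k |-> g (delta k), so that g k below stands
   for g (delta k); the same convention is used for functions on delta Z. *)
Definition gridfun (R : realType) (d : nat) := 'rV[int]_d -> R.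

Definition fdiff (R : realType) (g : int -> R) : int -> R :=
  fun k => g (k + 1) - g k.

Definition fdiffn (R : realType) (j : nat) (g : int -> R) : int -> R :=
  iter j (@fdiff R) g.

Definition interp_poly (R : realType) (delta : R) (g : int -> R)
    (k : int) (x : R) : R :=
  let t := (x - delta * k%:~R) / delta in
  g k
  + t * (fdiffn 1 g k - 1 / 2 * fdiffn 2 g k + 1 / 3 * fdiffn 3 g k)
  + 1 / 2 * t ^+ 2 * (fdiffn 2 g k - fdiffn 3 g k)
  + 1 / 6 * t ^+ 3 * fdiffn 3 g k
  + (- (23 / 3) * t ^+ 4 + 41 / 2 * t ^+ 5 - 55 / 3 * t ^+ 6
     + 11 / 2 * t ^+ 7) * fdiffn 4 g k.

(* interp_poly is linear in g, so the coefficient of g m is its value at the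
   indicator function of m; see interp_polyE. *)
Definition weight (R : realType) (delta : R) (k m : int) (x : R) : R :=
  interp_poly delta (fun n => (n == m)%:R) k x.

Lemma interp_polyE (R : realType) (delta : R) (g : int -> R) (k : int) (x : R) :
  interp_poly delta g k x =
  \sum_(i < 5) weight delta k (k + (i : nat)%:Z) x * g (k + (i : nat)%:Z).
Proof.
rewrite !big_ord_recl big_ord0 /= /weight /interp_poly /fdiffn /= /fdiff.
rewrite /bump /= -!addrA ?addr0.
have E (z : int) : (k == k + z) = (0 == z).
  by rewrite -{1}[k]addr0 (inj_eq (addrI k)).
have E' (z : int) : (k + z == k) = (z == 0).
  by rewrite -{2}[k]addr0 (inj_eq (addrI k)).
rewrite !(inj_eq (addrI k)) !E !E' /= eqxx /=.
ring.
Qed.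

Section Interpolation.
Variables (R : realType) (d : nat) (delta : R).
Implicit Types (g f : gridfun R d) (x : 'rV[R]_d) (k l : 'rV[int]_d).

Definition cell x : 'rV[int]_d := \row_j Num.floor (x 0 j / delta).

Definition offset (i : {ffun 'I_d -> 'I_5}) : 'rV[int]_d :=
  \row_j (i j : nat)%:Z.

Definition weights x (i : {ffun 'I_d -> 'I_5}) : R :=
  \prod_(j < d)
    weight delta (cell x 0 j) (cell x 0 j + offset i 0 j) (x 0 j).

Definition interp g x : R :=
  \sum_(i : {ffun 'I_d -> 'I_5}) weights x i * g (cell x + offset i).

Definition translate x l : 'rV[R]_d := x + delta *: map_mx intr l.

End Interpolation.

(* Summability over Z^d is the library's absolute summability; zsum is the
   value of the sum, and is meaningful only for summable families. *)
Definition zsummable (R : realType) (d : nat) (a : 'rV[int]_d -> R) : Prop :=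
  summable [set: 'rV[int]_d] (EFin \o a).

Definition zsum (R : realType) (d : nat) (a : 'rV[int]_d -> R) : R :=
  fine (\esum_(l in [set: 'rV[int]_d]) (EFin \o a)^\+ l
        - \esum_(l in [set: 'rV[int]_d]) (EFin \o a)^\- l)%E.

(* beta l k is the rate of the jump from delta k to delta (k + l). These are
   the off-diagonal conditions on a conservative Q-matrix with finite exit
   rates; every such family is the family of rates of a continuous-time Markov
   chain. There is no jump for l = 0, so beta 0 is irrelevant. *)
Definition transition_rates (R : realType) (d : nat)
    (beta : 'rV[int]_d -> gridfun R d) : Prop :=
  (forall l k, l != 0 -> 0 <= beta l k) /\
  (forall k, summable [set l | l != 0] (fun l => (beta l k)%:E)).

Section Generator.
Variables (R : realType) (d : nat) (delta : R).
Variables (beta : 'rV[int]_d -> gridfun R d) (f : gridfun R d).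

Definition generator_term (k l : 'rV[int]_d) : R :=
  beta l k * (f (k + l) - f k).

Definition generator : gridfun R d := fun k => zsum (generator_term k).

(* Even when every generator_term beta f k is summable, main_term and error_term
   need not be, since they contain products of beta l at one grid point with
   increments of f at another; their termwise sum always is. *)
Definition main_term (x : 'rV[R]_d) (l : 'rV[int]_d) : R :=
  interp delta (beta l) x
  * (interp delta f (translate delta x l) - interp delta f x).

Definition error_term (x : 'rV[R]_d) (l : 'rV[int]_d) : R :=
  let k := cell delta x in
  \sum_(i : {ffun 'I_d -> 'I_5})
    weights delta x i
    * (beta l (k + offset i) - interp delta (beta l) x)
    * (f (k + l + offset i) - f (k + offset i) - (f (k + l) - f k)).

Definition error (x : 'rV[R]_d) : R := zsum (error_term x).

End Generator.

(* Main.v *)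
Require Import Defs.
From mathcomp Require Import all_boot all_order all_algebra.
From mathcomp Require Import all_classical all_reals all_analysis.
From mathcomp Require Import ring.

Set Implicit Arguments.
Unset Strict Implicit.
Unset Printing Implicit Defensive.
Import Order.TTheory GRing.Theory Num.Theory.
Local Open Scope classical_set_scope.
Local Open Scope ring_scope.

(** Fix x, write k for its cell, w_i for the weights of the interpolation at x,
    b_i for the rate beta_l at k + i and D_i for f (k + i + l) - f (k + i).

    Two properties of the weights are used. They sum to 1 ([sum_weights]),
    because the one-dimensional interpolation reproduces constants; and they are
    unchanged when x moves by a grid vector ([weights_translate]), because they
    depend only on the relative position of x in its cell. By the second one,
    the increment of the interpolant of f from x to x + delta l is the weighted
    mean of the D_i, so the main term is the product of the weighted means of
    b and D, while the error term is a weighted covariance of b and D. As the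
    weights have total mass 1, the two add up to the weighted mean of b_i D_i
    ([weighted_covariance], [main_error_term]), which is a finite linear
    combination, with coefficients w_i, of generator terms at the points k + i.

    Each family of generator terms is absolutely summable over l, so this linear
    combination may be summed over l term by term ([zsum_lincomb]), and the
    result is the interpolant of the generator. So main
    plus error term is always summable, even though the main term alone need not
    be: it multiplies rates at one grid point by increments at another. As main
    and error term add up to a summable family, one of them is summable if and
    only if the other is, and in that case the sum splits. *)

(** * Linearity of absolutely convergent sums *)

(** Scaling by a nonnegative constant commutes with the supremum over finite
    partial sums. *)
Lemma esumZl (R : realType) (T : choiceType) (D : set T) (c : R)
    (a : T -> \bar R) : 0 <= c -> (forall i, 0 <= a i)%E ->
  (\esum_(i in D) (c%:E * a i) = c%:E * \esum_(i in D) a i)%E.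
Proof.
move=> c0 a0; rewrite /esum -ereal_supZl //; last first.
  by apply/set0P; exists 0%E; exists set0; rewrite ?fsbig_set0 //; exact: fsets_set0.
congr ereal_sup; rewrite image_comp; apply: eq_imagel => F _ /=.
by rewrite ge0_mule_fsumr.
Qed.

Section ZSum.
Variables (R : realType) (d : nat).
Implicit Types (a b : 'rV[int]_d -> R) (c : R).

Lemma zsummableD a b :
  zsummable a -> zsummable b -> zsummable (fun l => a l + b l).
Proof. exact: summableD. Qed.

Lemma zsummableZ c a : zsummable a -> zsummable (fun l => c * a l).
Proof.
rewrite /zsummable /summable => sa.
under eq_esum do rewrite /= normrM EFinM.
rewrite esumZl // lte_mul_pinfty ?lee_fin //.
Qed.

Let pos_summable a : zsummable a -> zsummable a^\+.
Proof. by move=> /summable_funepos; rewrite /zsummable -funerpos. Qed.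

Let neg_summable a : zsummable a -> zsummable a^\-.
Proof. by move=> /summable_funeneg; rewrite /zsummable -funerneg. Qed.

Let esum_fin a : zsummable a -> (forall l, 0 <= a l) ->
  (\esum_(l in [set: 'rV[int]_d]) (a l)%:E)%E \is a fin_num.
Proof.
move=> sa a0; move: sa; rewrite /zsummable summableE.
by under eq_esum do rewrite gee0_abs ?lee_fin //.
Qed.

(** The positive and negative parts are not additive, but the value of the sum
    does not depend on how the family is split into nonnegative ones, and this
    is what yields additivity. *)
Lemma zsumB a b : zsummable a -> zsummable b ->
    (forall l, 0 <= a l) -> (forall l, 0 <= b l) ->
  zsum (fun l => a l - b l)
  = fine (\esum_(l in [set: 'rV[int]_d]) (a l)%:E)
    - fine (\esum_(l in [set: 'rV[int]_d]) (b l)%:E).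
Proof.
move=> sa sb a0 b0; rewrite /zsum.
have -> : EFin \o (fun l => a l - b l) = ((EFin \o a) \- (EFin \o b))%E by [].
rewrite esumB // ?fineB ?esum_fin // => l _; by rewrite lee_fin.
Qed.

Lemma zsumE a : zsummable a ->
  zsum a = fine (\esum_(l in [set: 'rV[int]_d]) (a^\+ l)%:E)
           - fine (\esum_(l in [set: 'rV[int]_d]) (a^\- l)%:E).
Proof.
move=> sa; rewrite -{1}(funrposBneg a); apply: zsumB => //.
- exact: pos_summable.
- exact: neg_summable.
Qed.

Lemma zsumD a b : zsummable a -> zsummable b ->
  zsum (fun l => a l + b l) = zsum a + zsum b.
Proof.
move=> sa sb; rewrite (zsumE sa) (zsumE sb).
have -> : (fun l => a l + b l)
        = (fun l => (a^\+ l + b^\+ l) - (a^\- l + b^\- l)).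
  apply/funext => l; rewrite -{1}(funrposBneg a) -{1}(funrposBneg b) !fctE.
  by rewrite opprD addrACA.
have [pa na] := (pos_summable sa, neg_summable sa).
have [pb nb] := (pos_summable sb, neg_summable sb).
rewrite zsumB; last 4 first.
- exact: zsummableD.
- exact: zsummableD.
- by move=> l; rewrite addr_ge0.
- by move=> l; rewrite addr_ge0.
under eq_esum do rewrite EFinD.
under [X in _ - fine X]eq_esum do rewrite EFinD.
rewrite !esumD ?fineD ?esum_fin //; try by move=> l _; rewrite lee_fin.
by rewrite opprD addrACA.
Qed.

Lemma zsumZ c a : zsummable a -> zsum (fun l => c * a l) = c * zsum a.
Proof.
move=> sa; rewrite (zsumE sa) zsumE; last exact: zsummableZ.
have [pa na] := (pos_summable sa, neg_summable sa).
case: (leP 0 c) => [c0|/ltW c0].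
  rewrite ge0_funrposM // ge0_funrnegM //.
  under eq_esum do rewrite EFinM.
  under [X in _ - fine X]eq_esum do rewrite EFinM.
  by rewrite !esumZl // ?fineM ?esum_fin // -?mulrBr // => l; rewrite lee_fin.
have nc0 : 0 <= - c by rewrite oppr_ge0.
rewrite le0_funrposM // le0_funrnegM //.
under eq_esum do rewrite EFinM.
under [X in _ - fine X]eq_esum do rewrite EFinM.
rewrite !esumZl // ?fineM ?esum_fin //; try by move=> l; rewrite lee_fin.
by rewrite -mulrBr mulNr -mulrN opprB.
Qed.

Lemma zsummable0 : zsummable (fun _ : 'rV[int]_d => 0 : R).
Proof. by rewrite /zsummable /summable esum1 // => l _; rewrite /= normr0. Qed.

Lemma zsum0 : zsum (fun _ : 'rV[int]_d => 0 : R) = 0.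
Proof.
by have := zsumZ 0 zsummable0; rewrite !mul0r.
Qed.

Lemma zsum_lincomb (I : finType) (w : I -> R) (a : I -> 'rV[int]_d -> R) :
    (forall i, zsummable (a i)) ->
  zsummable (fun l => \sum_i w i * a i l) /\
  zsum (fun l => \sum_i w i * a i l) = \sum_i w i * zsum (a i).
Proof.
move=> sa; elim: (index_enum I) => [|i r [sr zr]].
  have -> : (fun l => \sum_(i <- [::]) w i * a i l) = fun=> 0.
    by apply/funext => l; rewrite big_nil.
  by rewrite big_nil zsum0; split=> //; exact: zsummable0.
have -> : (fun l => \sum_(j <- i :: r) w j * a j l)
        = (fun l => w i * a i l + \sum_(j <- r) w j * a j l).
  by apply/funext => l; rewrite big_cons.
have si := zsummableZ (w i) (sa i).
by rewrite big_cons zsumD // zsumZ // zr; split=> //; exact: zsummableD.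
Qed.

Lemma zsummable_finite (F : set 'rV[int]_d) a :
  finite_set F -> (forall l, ~ F l -> a l = 0) -> zsummable a.
Proof.
move=> finF a0; rewrite /zsummable /summable.
rewrite (_ : (\esum_(l in _) _)%E = (\esum_(l in F) `|a l|%:E)%E); last first.
  rewrite [RHS]esum_mkcond; apply: eq_esum => l _ /=.
  by case: ifPn => // /negP; rewrite inE => /a0 ->; rewrite normr0.
by rewrite esum_fset // fsbig_finite //= sumEFin ltry.
Qed.

End ZSum.

(** * The interpolation weights *)

(** The polynomial depends on [x] and [k] only through [(x - delta * k) / delta]
    and the values of [g] seen from [k]. *)
Lemma interp_poly_shift (R : realType) (delta : R) (g : int -> R) (k m : int)
    (x : R) :
  interp_poly delta g (k + m) (x + delta * m%:~R)
  = interp_poly delta (fun n => g (n + m)) k x.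
Proof.
rewrite /interp_poly /fdiffn /= /fdiff.
have -> : x + delta * m%:~R - delta * (k + m)%:~R = x - delta * k%:~R.
  by rewrite intrD; ring.
by rewrite ![_ + m + 1]addrAC.
Qed.

Lemma weight_shift (R : realType) (delta : R) (k n m : int) (x : R) :
  weight delta (k + m) (n + m) (x + delta * m%:~R) = weight delta k n x.
Proof.
rewrite /weight interp_poly_shift; congr interp_poly.
by apply/funext => p; rewrite (inj_eq (addIr m)).
Qed.

(** All differences of a constant vanish, so the interpolation reproduces
    constants. *)
Lemma sum_weight (R : realType) (delta : R) (k : int) (x : R) :
  \sum_(i < 5) weight delta k (k + (i : nat)%:Z) x = 1.
Proof.
have := interp_polyE delta (fun=> 1) k x.
under eq_bigr do rewrite mulr1.
by move=> <-; rewrite /interp_poly /fdiffn /= /fdiff; ring.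
Qed.

Section Weights.
Variables (R : realType) (d : nat) (delta : R).
Implicit Types (x : 'rV[R]_d) (l : 'rV[int]_d) (f : gridfun R d).

(** The sum of the tensor products of weights is the product over the coordinates
    of the one-dimensional sums. *)
Lemma sum_weights x : \sum_i weights delta x i = 1.
Proof.
pose F (j : 'I_d) (m : 'I_5) :=
  weight delta (cell delta x 0 j) (cell delta x 0 j + (m : nat)%:Z) (x 0 j).
rewrite (eq_bigr (fun i : {ffun 'I_d -> 'I_5} => \prod_j F j (i j))) => [|i _].
  rewrite -bigA_distr_bigA big1 // => j _.
  exact: sum_weight.
by rewrite /weights; apply: eq_bigr => j _; rewrite [offset i 0 j]mxE.
Qed.

Hypothesis delta0 : delta != 0.

Lemma cell_translate x l :
  cell delta (translate delta x l) = cell delta x + l.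
Proof.
apply/rowP => j; rewrite !mxE mulrDl mulrAC divff // mul1r.
by rewrite floorDrz ?intrKfloor // intr_int.
Qed.

Lemma weights_translate x l i :
  weights delta (translate delta x l) i = weights delta x i.
Proof.
rewrite /weights; apply: eq_bigr => j _; rewrite cell_translate !mxE addrAC.
exact: weight_shift.
Qed.

Lemma interp_translate f x l :
  interp delta f (translate delta x l)
  = \sum_i weights delta x i * f (cell delta x + l + offset i).
Proof.
by apply: eq_bigr => i _; rewrite weights_translate cell_translate.
Qed.

End Weights.

(** * Splitting the interpolated generator *)

(** The mean of a product is the product of the means plus a covariance, and a
    covariance is insensitive to shifting one of its factors by a constant.
    The shift [c] serves for the increment of the interpolated function at the
    corner of the cell. *)
Lemma weighted_covariance (R : comPzRingType) (I : finType) (w b D : I -> R)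
    (c : R) : \sum_i w i = 1 ->
  (\sum_i w i * b i) * (\sum_i w i * D i)
  + \sum_i w i * (b i - \sum_j w j * b j) * (D i - c)
  = \sum_i w i * (b i * D i).
Proof.
move=> w1; set B := \sum_j w j * b j.
rewrite [X in _ + X](eq_bigr (fun i => w i * (b i * D i) + (- B) * (w i * D i)
  + ((- c) * (w i * b i) + (c * B) * w i))); last by move=> i _; ring.
rewrite !big_split /= -!mulr_sumr -/B w1; ring.
Qed.

Section Split.
Variables (R : realType) (d : nat) (delta : R) (delta0 : delta != 0).
Variables (beta : 'rV[int]_d -> gridfun R d) (f : gridfun R d).

(** Once translated points are read in the cell of [x], main term and error term
    are the two halves of the covariance identity. *)
Lemma main_error_term (x : 'rV[R]_d) (l : 'rV[int]_d) :
  main_term delta beta f x l + error_term delta beta f x l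
  = \sum_i weights delta x i
            * generator_term beta f (cell delta x + offset i) l.
Proof.
rewrite /main_term /error_term interp_translate // /interp -sumrB.
under [X in _ * X + _]eq_bigr do rewrite -mulrBr.
rewrite weighted_covariance ?sum_weights //.
by apply: eq_bigr => i _; rewrite /generator_term [_ + l + _]addrAC.
Qed.

(** A jump contributes only if its rate is nonzero at one of the finitely many
    grid points used by the interpolation at [x]. *)
Lemma main_term_finite (x : 'rV[R]_d) :
    (forall k, finite_set [set l | beta l k != 0]) ->
  zsummable (main_term delta beta f x).
Proof.
move=> fin_beta; pose k i := cell delta x + offset i : 'rV[int]_d.
apply: (@zsummable_finite _ _ (\bigcup_(i in setT) [set l | beta l (k i) != 0])).
  by apply: bigcup_finite => // i _; exact: fin_beta.
move=> l Fl; rewrite /main_term /interp big1 ?mul0r // => i _.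
have [->|b0] := eqVneq (beta l (cell delta x + offset i)) 0; first exact: mulr0.
by case: Fl; exists i.
Qed.

End Split.

Theorem proposition3 (R : realType) (d : nat) (delta : R)
    (beta : 'rV[int]_d -> gridfun R d) (f : gridfun R d)
    (hd : (0 < d)%N) (hdelta : 0 < delta)
    (hbeta : transition_rates beta)
    (hsum : forall k : 'rV[int]_d, zsummable (generator_term beta f k))
    (x : 'rV[R]_d) :
  [/\ zsummable (fun l => main_term delta beta f x l
                          + error_term delta beta f x l)
      /\ interp delta (generator beta f) x
         = zsum (fun l => main_term delta beta f x l
                          + error_term delta beta f x l),
      zsummable (main_term delta beta f x)
        <-> zsummable (error_term delta beta f x),
      zsummable (main_term delta beta f x) ->
        interp delta (generator beta f) x
        = zsum (fun l => interp delta (beta l) x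
                         * (interp delta f (translate delta x l)
                            - interp delta f x))
          + error delta beta f x
    & (forall k, finite_set [set l | beta l k != 0]) ->
        zsummable (main_term delta beta f x)].
Proof.
have delta0 : delta != 0 by rewrite gt_eqF.
set main := main_term delta beta f x; set err := error_term delta beta f x.
have splitE : (fun l => main l + err l)
    = (fun l => \sum_i weights delta x i
         * generator_term beta f (cell delta x + offset i) l).
  by apply/funext => l; exact: main_error_term.
have [sT zT] := zsum_lincomb (weights delta x)
  (fun i => hsum (cell delta x + offset i)).
rewrite -splitE in sT zT.
have diffE (a b : 'rV[int]_d -> R) : (fun l => a l + b l + (-1) * a l) = b.
  by apply/funext => l; ring.
have main_err : zsummable main -> zsummable err.
  by move=> sm; rewrite -(diffE main err); exact/zsummableD/zsummableZ.
split=> //.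
- split=> // se; rewrite -(diffE err main).
  under eq_fun do rewrite [err _ + _]addrC.
  exact/zsummableD/zsummableZ.
- move=> sm; rewrite [LHS](esym zT) zsumD //; exact: main_err.
- exact: main_term_finite.
Qed.
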